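(* There exists an infinitely generated discrete subgroup $\Gamma<\mathrm{Isom}(\mathbb{H}^{2})$ such that the Hausdorff dimension of its nonconical limit set is zero: $\dim \Lambda_{nc}(\Gamma)=0$.
   Context: For a discrete subgroup $\Gamma<\mathrm{Isom}(\mathbb{H}^n)$, the limit set $\Lambda(\Gamma)\subset S^{n-1}=\partial_\infty\mathbb{H}^n$ is the accumulation set of a $\Gamma$-orbit. A limit point $\xi\in\Lambda(\Gamma)$ is nonconical if for some (equivalently every) $x\in\mathbb{H}^n$ the projection of the geodesic ray from $x$ to $\xi$ to the quotient $\mathbb{H}^n/\Gamma$ is a proper map (eventually leaves every compact set); $\Lambda_{nc}(\Gamma)$ denotes the set of nonconical limit points. Hausdorff dimension is taken with respect to the standard (angular/spherical) metric on the ideal boundary circle. *)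

(* Defs.v *)
From Stdlib Require Import Reals List.
From Coquelicot Require Import Coquelicot.
Open Scope R_scope.

(** Points of the plane; H^2 is the Poincare disk model
    {p | |p| < 1}, its ideal boundary S^1 = {p | |p| = 1}. *)
Definition pt := (R * R)%type.
Definition origin : pt := (0, 0).
Definition nrm2 (p : pt) : R := fst p * fst p + snd p * snd p.
Definition eucl_dist (p q : pt) : R :=
  sqrt ((fst p - fst q) ^ 2 + (snd p - snd q) ^ 2).
Definition in_disk (p : pt) : Prop := nrm2 p < 1.
Definition on_circle (p : pt) : Prop := nrm2 p = 1.
Definition scal (t : R) (p : pt) : pt := (t * fst p, t * snd p).

Definition arcosh (x : R) : R := ln (x + sqrt (x * x - 1)).

Definition hdist (z w : pt) : R :=
  arcosh (1 + 2 * ((fst z - fst w) ^ 2 + (snd z - snd w) ^ 2)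
                  / ((1 - nrm2 z) * (1 - nrm2 w))).

(** Isometries of H^2 (maps considered only through their values on the disk). *)
Definition is_isometry (g : pt -> pt) : Prop :=
  (forall x, in_disk x -> in_disk (g x)) /\
  (forall y, in_disk y -> exists x, in_disk x /\ g x = y) /\
  (forall x y, in_disk x -> in_disk y -> hdist (g x) (g y) = hdist x y).

Definition eq_on_disk (f g : pt -> pt) : Prop :=
  forall x, in_disk x -> f x = g x.

Definition is_subgroup (G : (pt -> pt) -> Prop) : Prop :=
  (forall g, G g -> is_isometry g) /\
  G (fun x => x) /\
  (forall g h, G g -> G h -> G (fun x => g (h x))) /\
  (forall g, G g -> exists h, G h /\ eq_on_disk (fun x => h (g x)) (fun x => x)
                                  /\ eq_on_disk (fun x => g (h x)) (fun x => x)).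

(** Discreteness in the compact-open topology: every element g is isolated,
    i.e. has a basic neighbourhood {h | sup_{x in K} d(h x, g x) < eps}
    (K a closed hyperbolic ball about the origin; every compact set lies in one)
    meeting G only in g. *)
Definition discrete_subgroup (G : (pt -> pt) -> Prop) : Prop :=
  is_subgroup G /\
  forall g, G g -> exists Rad eps, 0 < eps /\
    forall h, G h ->
      (forall x, in_disk x -> hdist origin x <= Rad -> hdist (h x) (g x) < eps) ->
      eq_on_disk h g.

Fixpoint word_comp (w : list (pt -> pt)) : pt -> pt :=
  match w with
  | nil => fun x => x
  | h :: w' => fun x => h (word_comp w' x)
  end.

Definition generated_by (G : (pt -> pt) -> Prop) (L : list (pt -> pt)) : Prop :=
  (forall l, In l L -> G l) /\
  forall g, G g -> exists w : list (pt -> pt),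
    (forall h, In h w ->
       In h L \/ (G h /\ exists l, In l L /\
                   eq_on_disk (fun x => h (l x)) (fun x => x))) /\
    eq_on_disk g (word_comp w).

Definition finitely_generated (G : (pt -> pt) -> Prop) : Prop :=
  exists L, generated_by G L.

Definition infinitely_generated (G : (pt -> pt) -> Prop) : Prop :=
  ~ finitely_generated G.

Definition limit_set (G : (pt -> pt) -> Prop) (xi : pt) : Prop :=
  on_circle xi /\
  forall eps, 0 < eps -> exists g, G g /\ eucl_dist (g origin) xi < eps.

(** Geodesic ray from the origin to xi, unit speed: r(t) = tanh(t/2) xi. *)
Definition geod_ray (xi : pt) (t : R) : pt := scal (tanh (t / 2)) xi.

(** Nonconical: the projection of the ray to H^2/G eventually leaves every
    compact set of the quotient; every compact set of the quotient lies in the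
    image of a closed ball B(origin, Rad), so this says: for every Rad,
    eventually r(t) is not in G.B(origin, Rad). *)
Definition nonconical_limit_set (G : (pt -> pt) -> Prop) (xi : pt) : Prop :=
  limit_set G xi /\
  forall Rad, exists T, forall t, T <= t -> forall g, G g ->
    forall y, in_disk y -> hdist origin y <= Rad -> g y <> geod_ray xi t.

Definition ang_dist (p q : pt) : R := acos (fst p * fst q + snd p * snd q).

(** Diameter (angular metric) of the part of U on the circle (0 if empty). *)
Definition ang_diam (U : pt -> Prop) : R :=
  match Lub_Rbar (fun d => exists p q, U p /\ U q /\ on_circle p /\ on_circle q
                                       /\ d = ang_dist p q) with
  | Finite r => r
  | _ => 0
  end.

(** d^s for d >= 0 and s > 0 (with 0^s = 0). *)
Definition rpow (d s : R) : R := if Rle_dec d 0 then 0 else Rpower d s.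

Definition hausdorff_delta (s delta : R) (A : pt -> Prop) : Rbar :=
  Glb_Rbar (fun v => exists U : nat -> pt -> Prop,
    (forall p, A p -> exists n, U n p) /\
    (forall n, ang_diam (U n) <= delta) /\
    is_series (fun n => rpow (ang_diam (U n)) s) v).

(** H^s(A) = sup_{delta > 0} H^s_delta(A); since each H^s_delta(A) >= 0,
    H^s(A) = 0 iff H^s_delta(A) = 0 for every delta > 0. *)
Definition hausdorff_null (s : R) (A : pt -> Prop) : Prop :=
  forall delta, 0 < delta -> hausdorff_delta s delta A = Finite 0.

Definition hausdorff_dim (A : pt -> Prop) : Rbar :=
  Glb_Rbar (fun s => 0 < s /\ hausdorff_null s A).

(* Main.v *)
From Stdlib Require Import Reals Ranalysis5.
From Coquelicot Require Import Coquelicot.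
From Stdlib Require Import List Lra Lia ClassicalEpsilon.
Require Import Defs.
Import ListNotations.
Open Scope R_scope.

(** The group is generated by the reflections in pairwise disjoint geodesics (walls) that
    accumulate at a single ideal point.  By ping-pong it is discrete and not finitely
    generated, and a limit point is either in the countable orbit of the accumulation point
    or is coded by the infinite sequence of walls crossed by the ray from the origin.  A
    crossing of a wall of index i happens at a point whose distance to the orbit of the
    origin is bounded in terms of i, so along the code of a nonconical limit point the
    indices tend to infinity.  The i-th reflection contracts by a factor that decays
    superexponentially in i; for every s > 0 its s-th power eventually beats the entropy of
    the code, so the cylinders of long prefixes of codes that tend to infinity form covers
    of arbitrarily small s-dimensional size. *)

(** * The Euclidean plane *)

Definition in_closed_disk (z : pt) : Prop := nrm2 z <= 1.

Definition sqdist (p q : pt) : R := (fst p - fst q) ^ 2 + (snd p - snd q) ^ 2.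

Lemma disk_closed_disk z : in_disk z -> in_closed_disk z.
Proof. apply Rlt_le. Qed.

Lemma circle_closed_disk z : on_circle z -> in_closed_disk z.
Proof. apply Req_le. Qed.

Lemma origin_in_disk : in_disk origin.
Proof. unfold in_disk, nrm2, origin; simpl; lra. Qed.

Lemma nrm2_ge0 z : 0 <= nrm2 z.
Proof. unfold nrm2; nra. Qed.

Lemma nrm2_scal s z : nrm2 (scal s z) = s ^ 2 * nrm2 z.
Proof. unfold nrm2, scal; simpl; ring. Qed.

Lemma sqdist_ge0 p q : 0 <= sqdist p q.
Proof. apply Rplus_le_le_0_compat; apply pow2_ge_0. Qed.

Lemma sqdist_origin z : sqdist z origin = nrm2 z.
Proof. unfold sqdist, nrm2, origin; simpl; ring. Qed.

Lemma eucl_dist_sqr p q : eucl_dist p q ^ 2 = sqdist p q.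
Proof. exact (pow2_sqrt _ (sqdist_ge0 p q)). Qed.

Lemma eucl_dist_ge0 p q : 0 <= eucl_dist p q.
Proof. apply sqrt_pos. Qed.

Lemma eucl_dist_sym p q : eucl_dist p q = eucl_dist q p.
Proof. unfold eucl_dist; f_equal; ring. Qed.

Lemma eucl_dist_triangle p q m : eucl_dist p q <= eucl_dist p m + eucl_dist m q.
Proof. unfold eucl_dist; rewrite <- !Rsqr_pow2; apply triangle. Qed.

Lemma eucl_dist_coord p q :
  Rabs (fst p - fst q) <= eucl_dist p q /\ Rabs (snd p - snd q) <= eucl_dist p q.
Proof.
  pose proof (proj1 (sqrt_plus_sqr (fst p - fst q) (snd p - snd q))) as H.
  split; (eapply Rle_trans; [|exact H]); [apply Rmax_l | apply Rmax_r].
Qed.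

Lemma eucl_dist_gt0 p q : p <> q -> 0 < eucl_dist p q.
Proof.
  intros Hne; destruct (eucl_dist_ge0 p q) as [|E]; [assumption|].
  exfalso; apply Hne; destruct (eucl_dist_coord p q) as [Hfst Hsnd]; rewrite <- E in *.
  apply Rabs_le_between in Hfst; apply Rabs_le_between in Hsnd.
  destruct p, q; simpl in *; f_equal; lra.
Qed.

Lemma eucl_dist_le_coord p q :
  eucl_dist p q <= Rabs (fst p - fst q) + Rabs (snd p - snd q).
Proof.
  pose proof (Rabs_pos (fst p - fst q)); pose proof (Rabs_pos (snd p - snd q)).
  apply Rsqr_incr_0_var; [|lra].
  rewrite Rsqr_pow2, eucl_dist_sqr; unfold sqdist, Rsqr.
  rewrite <- (pow2_abs (fst p - fst q)), <- (pow2_abs (snd p - snd q)); nra.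
Qed.

Lemma eucl_dist_origin z : eucl_dist z origin = sqrt (nrm2 z).
Proof. rewrite <- sqdist_origin; reflexivity. Qed.

Lemma eucl_dist_closed_disk_le2 p q : in_closed_disk p -> in_closed_disk q ->
  eucl_dist p q <= 2.
Proof.
  intros Hp Hq; eapply Rle_trans; [apply (eucl_dist_triangle _ _ origin)|].
  rewrite (eucl_dist_sym origin), !eucl_dist_origin.
  apply sqrt_le_1_alt in Hp, Hq; rewrite sqrt_1 in Hp, Hq; lra.
Qed.

Lemma locally_eucl_dist (z : R * R) (P : pt -> Prop) :
  locally z P <-> exists d, 0 < d /\ forall y, eucl_dist y z < d -> P y.
Proof.
  split.
  - intros [d Hd]; exists d; split; [apply cond_pos|]; intros y Hy; apply Hd.
    destruct (eucl_dist_coord y z); split; eapply Rle_lt_trans; eassumption.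
  - intros (d & Hd & H); exists (pos_div_2 (mkposreal d Hd)); intros y [Bfst Bsnd]; apply H.
    eapply Rle_lt_trans; [apply eucl_dist_le_coord|].
    replace d with (d / 2 + d / 2) by lra; exact (Rplus_lt_compat _ _ _ _ Bfst Bsnd).
Qed.

Lemma continuous_pair {T : UniformSpace} (f g : T -> R) x :
  continuous f x -> continuous g x -> continuous (fun t => (f t, g t)) x.
Proof.
  intros Hf Hg; apply (continuous_comp_2 f g pair x Hf Hg).
  apply continuous_ext with (fun z : R * R => z); [intros [a b]; reflexivity|].
  apply continuous_id.
Qed.

Lemma continuous_sqdist c (z : R * R) : continuous (fun y : R * R => sqdist y c) z.
Proof.
  unfold sqdist; simpl.
  assert (fst_cont : continuous (fun y : R * R => fst y - fst c) z)
    by (apply @continuous_minus; [destruct z; apply continuous_fst | apply continuous_const]).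
  assert (snd_cont : continuous (fun y : R * R => snd y - snd c) z)
    by (apply @continuous_minus; [destruct z; apply continuous_snd | apply continuous_const]).
  apply @continuous_plus; repeat (apply @continuous_mult; [assumption|]);
    apply continuous_const.
Qed.

Lemma scal_0 z : scal 0 z = origin.
Proof. unfold scal, origin; f_equal; ring. Qed.

Lemma scal_1 z : scal 1 z = z.
Proof. destruct z; unfold scal; simpl; f_equal; ring. Qed.

Lemma eucl_dist_radius xi s t : on_circle xi -> s <= t ->
  eucl_dist (scal s xi) (scal t xi) = t - s.
Proof.
  intros Hxi Hst; rewrite <- (sqrt_pow2 (t - s)) by lra; unfold eucl_dist; f_equal.
  transitivity ((t - s) ^ 2 * nrm2 xi); [unfold scal, nrm2; simpl; ring|].
  rewrite Hxi; ring.
Qed.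

Lemma scal_in_disk s xi : on_circle xi -> 0 <= s < 1 -> in_disk (scal s xi).
Proof. intros Hxi Hs; red; rewrite nrm2_scal, Hxi; nra. Qed.

Lemma scal_in_closed_disk s xi : on_circle xi -> 0 <= s <= 1 -> in_closed_disk (scal s xi).
Proof. intros Hxi Hs; red; rewrite nrm2_scal, Hxi; nra. Qed.

Lemma continuous_scal z s : continuous (fun t => scal t z : R * R) s.
Proof.
  apply continuous_pair; apply @continuous_mult;
    first [apply continuous_id | apply continuous_const].
Qed.

(** * Inversions in circles orthogonal to the unit circle *)

Definition inversion (c : pt) (r : R) (z : pt) : pt :=
  (fst c + r ^ 2 / sqdist z c * (fst z - fst c),
   snd c + r ^ 2 / sqdist z c * (snd z - snd c)).

Lemma inversion_dist_center c r z : 0 < eucl_dist z c ->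
  eucl_dist (inversion c r z) c = r ^ 2 / eucl_dist z c.
Proof.
  intros Hz; apply Rsqr_inj; [apply eucl_dist_ge0 | apply Rdiv_le_0_compat; nra |].
  assert (0 < sqdist z c) by (rewrite <- eucl_dist_sqr; nra).
  transitivity (r ^ 4 / sqdist z c).
  - rewrite Rsqr_pow2, eucl_dist_sqr; revert H; destruct c as [c1 c2], z as [z1 z2].
    unfold inversion, sqdist; simpl fst; simpl snd; intros; field; lra.
  - rewrite <- eucl_dist_sqr; unfold Rsqr; field; lra.
Qed.

Lemma inversion_dist c r z w : 0 < eucl_dist z c -> 0 < eucl_dist w c ->
  eucl_dist (inversion c r z) (inversion c r w) =
  r ^ 2 * eucl_dist z w / (eucl_dist z c * eucl_dist w c).
Proof.
  intros Hz Hw; pose proof (eucl_dist_ge0 z w).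
  apply Rsqr_inj; [apply eucl_dist_ge0 | apply Rdiv_le_0_compat; nra |].
  assert (Sz : 0 < sqdist z c) by (rewrite <- eucl_dist_sqr; nra).
  assert (Sw : 0 < sqdist w c) by (rewrite <- eucl_dist_sqr; nra).
  transitivity (r ^ 4 * sqdist z w / (sqdist z c * sqdist w c)).
  - rewrite Rsqr_pow2, eucl_dist_sqr; revert Sz Sw.
    destruct c as [c1 c2], z as [z1 z2], w as [w1 w2].
    unfold inversion, sqdist; simpl fst; simpl snd; intros; field; split; lra.
  - rewrite <- !eucl_dist_sqr; unfold Rsqr; field; split; lra.
Qed.

Lemma inversion_involutive c r z :
  0 < r -> 0 < eucl_dist z c -> inversion c r (inversion c r z) = z.
Proof.
  intros Hr Hz.
  assert (H : sqdist (inversion c r z) c = (r ^ 2 / eucl_dist z c) ^ 2)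
    by (rewrite <- eucl_dist_sqr, inversion_dist_center; auto).
  unfold inversion at 1; rewrite H; unfold inversion; rewrite <- eucl_dist_sqr.
  destruct z as [z1 z2]; simpl fst; simpl snd; f_equal; field; split; lra.
Qed.

Lemma continuous_inversion c r (z : R * R) :
  0 < eucl_dist z c -> continuous (inversion c r : R * R -> R * R) z.
Proof.
  intros Hz; assert (Hs : sqdist z c <> 0) by (rewrite <- eucl_dist_sqr; nra).
  assert (Ck : continuous (fun y : R * R => r ^ 2 / sqdist y c) z).
  { apply @continuous_mult; [apply continuous_const|].
    apply (continuous_comp (fun y : R * R => sqdist y c) Rinv);
      [apply continuous_sqdist | apply continuous_Rinv, Hs]. }
  apply continuous_pair; apply @continuous_plus; try apply continuous_const;
    apply @continuous_mult; [exact Ck | | exact Ck |];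
    apply @continuous_minus; try apply continuous_const; destruct z;
    [apply continuous_fst | apply continuous_snd].
Qed.

(* [|a - b| (1 - |z|^2) / (|z - a| |z - b|)] is a conformal invariant of the disk,
   and it is at least 1 when z lies on the radius from a = 0 to a point b of the circle. *)
Definition near_geodesic (a b z : pt) : Prop :=
  eucl_dist z a * eucl_dist z b <= eucl_dist a b * (1 - nrm2 z).

Lemma near_geodesic_radius s xi : on_circle xi -> 0 <= s <= 1 ->
  near_geodesic origin xi (scal s xi).
Proof.
  intros Hxi Hs; red; rewrite nrm2_scal, Hxi, (eucl_dist_sym _ origin).
  pose proof (eucl_dist_radius xi 0 s Hxi) as dist_0_s.
  pose proof (eucl_dist_radius xi s 1 Hxi) as dist_s_1.
  pose proof (eucl_dist_radius xi 0 1 Hxi) as dist_0_1.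
  rewrite scal_0, ?scal_1 in *; rewrite dist_0_s, dist_s_1, dist_0_1 by lra; nra.
Qed.

Lemma near_geodesic_depth a b z d e :
  in_closed_disk a -> in_closed_disk b -> in_closed_disk z -> near_geodesic a b z ->
  0 <= d <= eucl_dist z a -> 0 <= e <= eucl_dist z b -> d * e <= 2 * (1 - nrm2 z).
Proof.
  intros Ha Hb Hz Hnear Hd He; pose proof (eucl_dist_closed_disk_le2 a b Ha Hb).
  unfold in_closed_disk, near_geodesic in *.
  apply Rle_trans with (eucl_dist z a * eucl_dist z b).
  - apply Rmult_le_compat; lra.
  - eapply Rle_trans; [exact Hnear|]; apply Rmult_le_compat_r; lra.
Qed.

Lemma hdist_eucl_dist z w :
  hdist z w = arcosh (1 + 2 * eucl_dist z w ^ 2 / ((1 - nrm2 z) * (1 - nrm2 w))).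
Proof. rewrite eucl_dist_sqr; reflexivity. Qed.

Section OrthogonalInversion.

Variables (c : pt) (r : R).
Hypotheses (r_gt0 : 0 < r) (orth : nrm2 c = 1 + r ^ 2).

Lemma center_dist_gt0 z : in_closed_disk z -> 0 < eucl_dist z c.
Proof. intros H; apply eucl_dist_gt0; intros ->; unfold in_closed_disk in H; nra. Qed.

Lemma nrm2_inversion z : in_closed_disk z ->
  1 - nrm2 (inversion c r z) = r ^ 2 * (1 - nrm2 z) / eucl_dist z c ^ 2.
Proof.
  intros Hz; pose proof (center_dist_gt0 z Hz).
  assert (Hs : 0 < sqdist z c) by (rewrite <- eucl_dist_sqr; nra); revert Hs.
  assert (E : r ^ 2 = nrm2 c - 1) by lra.
  rewrite eucl_dist_sqr; unfold inversion; rewrite E.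
  destruct c as [c1 c2], z as [z1 z2]; unfold sqdist, nrm2; simpl fst; simpl snd.
  intros; field; lra.
Qed.

Lemma inversion_closed_disk z : in_closed_disk z -> in_closed_disk (inversion c r z).
Proof.
  intros Hz; pose proof (nrm2_inversion z Hz); pose proof (center_dist_gt0 z Hz).
  unfold in_closed_disk in *.
  assert (0 <= r ^ 2 * (1 - nrm2 z) / eucl_dist z c ^ 2); [|lra].
  apply Rdiv_le_0_compat; [apply Rmult_le_pos|]; nra.
Qed.

Lemma inversion_disk z : in_disk z -> in_disk (inversion c r z).
Proof.
  intros Hz; pose proof (disk_closed_disk z Hz) as Hc.
  pose proof (nrm2_inversion z Hc); pose proof (center_dist_gt0 z Hc).
  unfold in_disk in *.
  assert (0 < r ^ 2 * (1 - nrm2 z) / eucl_dist z c ^ 2); [|lra].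
  apply Rdiv_lt_0_compat; [apply Rmult_lt_0_compat|]; nra.
Qed.

Lemma inversion_circle z : on_circle z -> on_circle (inversion c r z).
Proof.
  intros Hz; pose proof (nrm2_inversion z (circle_closed_disk z Hz)) as H.
  unfold on_circle in *; rewrite Hz, Rminus_diag in H; unfold Rdiv in H.
  rewrite Rmult_0_r, Rmult_0_l in H; lra.
Qed.

Lemma hdist_inversion z w : in_disk z -> in_disk w ->
  hdist (inversion c r z) (inversion c r w) = hdist z w.
Proof.
  intros Hz Hw; pose proof (disk_closed_disk z Hz); pose proof (disk_closed_disk w Hw).
  pose proof (center_dist_gt0 z ltac:(assumption)).
  pose proof (center_dist_gt0 w ltac:(assumption)).
  rewrite !hdist_eucl_dist, !nrm2_inversion, inversion_dist by assumption.
  unfold in_disk in *; f_equal; field; repeat split; lra.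
Qed.

Lemma near_geodesic_inversion a b z :
  in_closed_disk a -> in_closed_disk b -> in_closed_disk z ->
  near_geodesic a b z ->
  near_geodesic (inversion c r a) (inversion c r b) (inversion c r z).
Proof.
  intros Ha Hb Hz H; unfold near_geodesic in *.
  pose proof (center_dist_gt0 a Ha); pose proof (center_dist_gt0 b Hb).
  pose proof (center_dist_gt0 z Hz).
  rewrite nrm2_inversion, !inversion_dist by assumption.
  set (k := r ^ 4 / (eucl_dist a c * eucl_dist b c * eucl_dist z c ^ 2)).
  assert (Hk : 0 <= k).
  { apply Rdiv_le_0_compat; [apply pow_le; lra|].
    repeat apply Rmult_lt_0_compat; simpl; lra. }
  apply (Rmult_le_compat_l k _ _ Hk) in H.
  replace (_ * _) with (k * (eucl_dist z a * eucl_dist z b)) by (unfold k; field; lra).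
  replace (_ * _ / _ * _) with (k * (eucl_dist a b * (1 - nrm2 z)))
    by (unfold k; field; lra).
  exact H.
Qed.

End OrthogonalInversion.

(** * Hyperbolic distance to the origin *)

Lemma arcosh_le x y : 1 <= x <= y -> arcosh x <= arcosh y.
Proof.
  intros [Hx Hxy]; unfold arcosh; apply ln_le.
  - pose proof (sqrt_pos (x * x - 1)); lra.
  - apply Rplus_le_compat; [exact Hxy|]; apply sqrt_le_1_alt; nra.
Qed.

Lemma ln_le_arcosh x : 0 < x -> ln x <= arcosh x.
Proof. intros H; apply ln_le; [exact H|]; pose proof (sqrt_pos (x * x - 1)); lra. Qed.

Lemma hdist_origin z : hdist origin z = arcosh (1 + 2 * nrm2 z / (1 - nrm2 z)).
Proof.
  rewrite hdist_eucl_dist, eucl_dist_sym, eucl_dist_sqr, sqdist_origin.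
  replace (nrm2 origin) with 0 by (unfold nrm2; simpl; ring).
  rewrite Rminus_0_r, Rmult_1_l; reflexivity.
Qed.

Lemma hdist_origin_ge m z : in_disk z -> 0 <= m <= nrm2 z -> ln (1 + 2 * m) <= hdist origin z.
Proof.
  unfold in_disk; intros Hz Hm; rewrite hdist_origin.
  assert (2 * m <= 2 * nrm2 z / (1 - nrm2 z)) by (apply -> Rle_div_r; nra).
  eapply Rle_trans; [|apply ln_le_arcosh]; [apply ln_le|]; lra.
Qed.

Lemma hdist_origin_le d z : 0 < d <= 1 - nrm2 z -> hdist origin z <= arcosh (1 + 2 / d).
Proof.
  intros [Hd Hdz]; rewrite hdist_origin; pose proof (nrm2_ge0 z).
  assert (0 <= 2 * nrm2 z / (1 - nrm2 z)) by (apply Rdiv_le_0_compat; lra).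
  apply arcosh_le; split; [lra|]; apply Rplus_le_compat_l.
  unfold Rdiv; apply Rmult_le_compat; [lra | | lra | apply Rinv_le_contravar; lra].
  left; apply Rinv_0_lt_compat; lra.
Qed.

Lemma tanh_half_ln s : -1 < s < 1 -> tanh (ln ((1 + s) / (1 - s)) / 2) = s.
Proof.
  intros Hs; set (L := ln _).
  assert (E : exp (L / 2) * exp (L / 2) = (1 + s) / (1 - s)).
  { rewrite <- exp_plus; replace (L / 2 + L / 2) with L by lra.
    apply exp_ln, Rdiv_lt_0_compat; lra. }
  pose proof (exp_pos (L / 2)); unfold tanh, sinh, cosh; rewrite exp_Ropp.
  set (e := exp (L / 2)) in *.
  apply Rmult_eq_reg_r with (e * e + 1); [|nra].
  transitivity (e * e - 1); [field; nra|].
  rewrite E; field; lra.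
Qed.

Lemma geod_ray_reaches xi T s : 0 <= s < 1 -> 1 - s <= exp (- T) ->
  exists t, T <= t /\ geod_ray xi t = scal s xi.
Proof.
  intros Hs HT; exists (ln ((1 + s) / (1 - s))); split.
  - rewrite <- (ln_exp T); apply ln_le; [apply exp_pos|].
    rewrite exp_Ropp in HT; pose proof (exp_pos T).
    apply -> Rle_div_r; [|lra].
    apply (Rmult_le_compat_l (exp T)) in HT; [|lra].
    rewrite Rinv_r in HT by lra; lra.
  - unfold geod_ray; rewrite tanh_half_ln by lra; reflexivity.
Qed.

(** * Groups of isometries of the disk *)

Lemma is_isometry_ext (g h : pt -> pt) : eq_on_disk g h -> is_isometry h -> is_isometry g.
Proof.
  intros E (Hdisk & Hsurj & Hdist); repeat split.
  - intros x Hx; rewrite E by exact Hx; auto.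
  - intros y Hy; destruct (Hsurj y Hy) as (x & Hx & Ex); exists x; rewrite E; auto.
  - intros x y Hx Hy; rewrite !E; auto.
Qed.

Definition respects_eq_on_disk (H : (pt -> pt) -> Prop) : Prop :=
  forall g h, eq_on_disk g h -> H h -> H g.

Lemma subgroup_inverse_mem H g h : is_subgroup H -> respects_eq_on_disk H -> H g ->
  eq_on_disk (fun x => h (g x)) (fun x => x) -> H h.
Proof.
  intros (Hiso & _ & _ & Hinv) Hext Hg E.
  destruct (Hinv g Hg) as (g' & Hg' & _ & E'); apply Hext with g'; [|exact Hg'].
  intros x Hx; pose proof (proj1 (Hiso g' Hg') x Hx) as Hy.
  rewrite <- (E _ Hy), (E' x Hx); reflexivity.
Qed.

Lemma subgroup_word_comp H w : is_subgroup H -> (forall h, In h w -> H h) -> H (word_comp w).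
Proof.
  intros (_ & Hid & Hcomp & _) Hw; induction w as [|h w IH]; [exact Hid|].
  apply (Hcomp h (word_comp w)); [apply Hw; left; reflexivity|].
  apply IH; intros k Hk; apply Hw; right; exact Hk.
Qed.

Lemma generated_by_subset G H L : generated_by G L -> is_subgroup H -> respects_eq_on_disk H ->
  (forall l, In l L -> H l) -> forall g, G g -> H g.
Proof.
  intros [_ Hgen] Hsub Hext HL g Hg; destruct (Hgen g Hg) as (w & Hw & E).
  apply Hext with (1 := E), subgroup_word_comp; [exact Hsub|]; intros h Hh.
  destruct (Hw h Hh) as [Hl | (_ & l & Hl & El)]; [exact (HL h Hl)|].
  exact (subgroup_inverse_mem H l h Hsub Hext (HL l Hl) El).
Qed.

(* It is enough to compare displacements of the origin, because for [k] inverse to [h]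
   the isometry [k g] moves the origin by [hdist (h origin) (g origin)]. *)
Lemma discrete_of_displacement_gap G eps : is_subgroup G -> 0 < eps ->
  (forall g, G g -> hdist origin (g origin) < eps -> eq_on_disk g (fun x => x)) ->
  discrete_subgroup G.
Proof.
  intros Hsub Heps Hgap; split; [exact Hsub|].
  destruct Hsub as (Hiso & _ & Hcomp & Hinv); pose proof origin_in_disk as O.
  intros g Hg; exists (hdist origin origin), eps; split; [exact Heps|]; intros h Hh Hclose.
  destruct (Hinv h Hh) as (k & Hk & Ekh & Ehk).
  pose proof (Hiso g Hg) as (Dg & _ & _); pose proof (Hiso h Hh) as (Dh & _ & _).
  destruct (Hiso k Hk) as (_ & _ & Ik).
  assert (Ekg : eq_on_disk (fun x => k (g x)) (fun x => x)).
  { apply Hgap; [exact (Hcomp k g Hk Hg)|].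
    rewrite <- (Ekh origin O) at 1; rewrite Ik by auto.
    apply Hclose; [exact O | apply Rle_refl]. }
  intros x Hx; rewrite <- (Ekg x Hx) at 1; exact (Ehk (g x) (Dg x Hx)).
Qed.

Lemma limit_set_invariant G g xi : is_subgroup G -> G g ->
  continuous (g : R * R -> R * R) xi -> on_circle (g xi) ->
  limit_set G xi -> limit_set G (g xi).
Proof.
  intros (_ & _ & Hcomp & _) Hg Hcont Hcirc [_ Hlim]; split; [exact Hcirc|].
  intros eps Heps.
  assert (Hnear : locally (g xi : R * R) (fun y => eucl_dist y (g xi) < eps))
    by (apply locally_eucl_dist; exists eps; auto).
  destruct (proj1 (locally_eucl_dist _ _) (Hcont _ Hnear)) as (d & Hd & Hball).
  destruct (Hlim d Hd) as (h & Hh & Hdist).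
  exists (fun x => g (h x)); split; [exact (Hcomp g h Hg Hh) | exact (Hball _ Hdist)].
Qed.

(** * Hausdorff measure on the circle *)

Lemma Glb_Rbar_eq0 (E : R -> Prop) : (forall v, E v -> 0 <= v) ->
  (Glb_Rbar E = Finite 0 <-> forall eps, 0 < eps -> exists v, E v /\ v < eps).
Proof.
  intros Hpos; split.
  - intros H eps Heps; apply NNPP; intros Hno.
    pose proof (Glb_Rbar_correct E) as [_ Hglb]; rewrite H in Hglb.
    assert (Hle : eps <= 0); [|lra].
    apply (Hglb (Finite eps)); intros v Hv; apply Rnot_lt_le; intros Hlt.
    apply Hno; exists v; split; assumption.
  - intros H; apply is_glb_Rbar_unique; split; [exact Hpos|].
    intros [b| |] Hb; simpl; [| |exact I].
    + apply Rnot_lt_le; intros Hlt; destruct (H b Hlt) as (v & Hv & Hvb).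
      specialize (Hb v Hv); simpl in Hb; lra.
    + destruct (H 1 Rlt_0_1) as (v & Hv & _); exact (Hb v Hv).
Qed.

Lemma ang_diam_le U b : 0 <= b ->
  (forall p q, U p -> U q -> on_circle p -> on_circle q -> ang_dist p q <= b) ->
  ang_diam U <= b.
Proof.
  intros Hb H; unfold ang_diam.
  match goal with |- context [Lub_Rbar ?E] => pose proof (Lub_Rbar_correct E) as [_ Hlub] end.
  specialize (Hlub (Finite b)); destruct (Lub_Rbar _) as [r| |]; [|lra|lra].
  apply Hlub; intros d (p & q & Up & Uq & Cp & Cq & ->); apply H; assumption.
Qed.

Lemma ang_diam_ext U V : (forall p, U p <-> V p) -> ang_diam U = ang_diam V.
Proof.
  intros H; unfold ang_diam; erewrite Lub_Rbar_eqset; [reflexivity|].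
  intros d; split; intros (p & q & Up & Uq & Hpq); exists p, q; apply H in Up, Uq; auto.
Qed.

Lemma ang_diam_subsingleton U : (forall p q, U p -> U q -> p = q) -> ang_diam U <= 0.
Proof.
  intros H; apply ang_diam_le; [lra|]; intros p q Up Uq Cp _.
  rewrite <- (H p q Up Uq); unfold ang_dist.
  fold (nrm2 p); rewrite Cp, acos_1; lra.
Qed.

Lemma acos_le_chord x : -1 <= x <= 1 -> acos x <= 3 * sqrt (2 - 2 * x).
Proof.
  intros Hx; pose proof (acos_bound x); set (t := acos x) in *; pose proof PI_4.
  assert (chord : 2 - 2 * x = (2 * sin (t / 2)) ^ 2).
  { replace x with (cos (2 * (t / 2))); [rewrite cos_2a_sin; ring|].
    replace (2 * (t / 2)) with t by lra; apply cos_acos, Hx. }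
  assert (0 <= sin (t / 2)) by (apply sin_ge_0; lra).
  rewrite chord, sqrt_pow2 by lra.
  destruct (pre_sin_bound (t / 2) 0) as [taylor _]; [lra|lra|].
  replace (sin_approx _ _) with (t / 2 - t / 2 * ((t / 2) ^ 2 / 6)) in taylor
    by (unfold sin_approx, sin_term; simpl; field).
  assert ((t / 2) ^ 2 <= 4) by nra; nra.
Qed.

Lemma ang_dist_le p q : on_circle p -> on_circle q -> ang_dist p q <= 3 * eucl_dist p q.
Proof.
  destruct p as [p1 p2], q as [q1 q2]; unfold on_circle, nrm2, ang_dist, eucl_dist.
  simpl fst; simpl snd; intros Hp Hq.
  replace ((p1 - q1) ^ 2 + (p2 - q2) ^ 2) with (2 - 2 * (p1 * q1 + p2 * q2)).
  - apply acos_le_chord.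
    pose proof (pow2_ge_0 (p1 - q1)); pose proof (pow2_ge_0 (p2 - q2)).
    pose proof (pow2_ge_0 (p1 + q1)); pose proof (pow2_ge_0 (p2 + q2)); split; nra.
  - replace 2 with (1 + 1) at 1 by ring; rewrite <- Hp at 1; rewrite <- Hq; ring.
Qed.

Lemma rpow_ge0 d s : 0 <= rpow d s.
Proof. unfold rpow; destruct (Rle_dec d 0); [lra | left; apply exp_pos]. Qed.

Lemma rpow_nonpos d s : d <= 0 -> rpow d s = 0.
Proof. intros H; unfold rpow; destruct (Rle_dec d 0); [reflexivity | contradiction]. Qed.

Lemma rpow_le_Rpower d b s : 0 <= s -> d <= b -> rpow d s <= Rpower b s.
Proof.
  intros Hs H; unfold rpow; destruct (Rle_dec d 0); [left; apply exp_pos|].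
  apply Rle_Rpower_l; lra.
Qed.

Definition delta_cover (s delta : R) (A : pt -> Prop) (v : R) : Prop :=
  exists U : nat -> pt -> Prop,
    (forall p, A p -> exists n, U n p) /\
    (forall n, ang_diam (U n) <= delta) /\
    is_series (fun n => rpow (ang_diam (U n)) s) v.

Lemma is_series_ge0 (a : nat -> R) v : (forall n, 0 <= a n) -> is_series a v -> 0 <= v.
Proof.
  intros Ha Hv; apply (is_lim_seq_le (fun _ => 0) (sum_n a) 0 v).
  - intros n; rewrite sum_n_Reals; apply cond_pos_sum, Ha.
  - apply is_lim_seq_const.
  - exact Hv.
Qed.

Lemma delta_cover_ge0 s delta A v : delta_cover s delta A v -> 0 <= v.
Proof.
  intros (U & _ & _ & HU); apply is_series_ge0 with (2 := HU); intros n; apply rpow_ge0.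
Qed.

Lemma hausdorff_null_iff s A : hausdorff_null s A <->
  forall delta eps, 0 < delta -> 0 < eps -> exists v, delta_cover s delta A v /\ v < eps.
Proof.
  pose proof (fun delta => Glb_Rbar_eq0 _ (delta_cover_ge0 s delta A)) as Hglb.
  split; intros H delta.
  - intros eps Hdelta; revert eps; exact (proj1 (Hglb delta) (H delta Hdelta)).
  - intros Hdelta; apply (proj2 (Hglb delta)); auto.
Qed.

Lemma hausdorff_null_subset s (A B : pt -> Prop) : (forall p, A p -> B p) ->
  hausdorff_null s B -> hausdorff_null s A.
Proof.
  rewrite !hausdorff_null_iff; intros HAB H delta eps Hdelta Heps.
  destruct (H delta eps Hdelta Heps) as (v & (U & Hcov & HU) & Hv).
  exists v; split; [exists U; split; [|exact HU]; auto | exact Hv].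
Qed.

Definition interleave {T} (u v : nat -> T) (n : nat) : T :=
  if Nat.even n then u (Nat.div2 n) else v (Nat.div2 n).

Lemma interleave_even {T} (u v : nat -> T) n : interleave u v (2 * n) = u n.
Proof. unfold interleave; rewrite Nat.even_even, Nat.div2_double; reflexivity. Qed.

Lemma interleave_odd {T} (u v : nat -> T) n : interleave u v (2 * n + 1) = v n.
Proof.
  unfold interleave; rewrite Nat.even_odd, Nat.add_1_r, Nat.div2_succ_double; reflexivity.
Qed.

(* The odd-even splitting of a power series, evaluated at 1. *)
Lemma is_series_interleave (a b : nat -> R) la lb :
  is_series a la -> is_series b lb -> is_series (interleave a b) (la + lb).
Proof.
  intros Ha Hb; assert (E : forall (c : nat -> R) n, c n * 1 ^ n = c n)
    by (intros; rewrite pow1; ring).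
  apply (is_series_ext _ _ _ (E _)), is_pseries_R.
  replace (la + lb) with (la + 1 * lb) by ring.
  apply is_pseries_odd_even; rewrite pow1; apply is_pseries_R.
  - apply is_series_ext with (2 := Ha); intros n; rewrite pow1, interleave_even.
    symmetry; apply Rmult_1_r.
  - apply is_series_ext with (2 := Hb); intros n; rewrite pow1, interleave_odd.
    symmetry; apply Rmult_1_r.
Qed.

Lemma hausdorff_null_union s (A B : pt -> Prop) :
  hausdorff_null s A -> hausdorff_null s B -> hausdorff_null s (fun p => A p \/ B p).
Proof.
  rewrite !hausdorff_null_iff; intros HA HB delta eps Hdelta Heps.
  destruct (HA delta (eps / 2)) as (v & (U & Ucov & Udiam & Usum) & Hv); [lra|lra|].
  destruct (HB delta (eps / 2)) as (v' & (V & Vcov & Vdiam & Vsum) & Hv'); [lra|lra|].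
  exists (v + v'); split; [exists (interleave U V); split; [|split] | lra].
  - intros p [Ap|Bp].
    + destruct (Ucov p Ap) as [n Un]; exists (2 * n)%nat; rewrite interleave_even; exact Un.
    + destruct (Vcov p Bp) as [n Vn]; exists (2 * n + 1)%nat; rewrite interleave_odd; exact Vn.
  - intros n; unfold interleave; destruct (Nat.even n); auto.
  - apply is_series_ext with (2 := is_series_interleave _ _ _ _ Usum Vsum).
    intros n; unfold interleave; destruct (Nat.even n); reflexivity.
Qed.

Lemma is_series_inv_pronic : is_series (fun n => / ((INR n + 1) * (INR n + 2))) 1.
Proof.
  assert (telescope : forall n,
    1 - / (INR n + 2) = sum_n (fun n => / ((INR n + 1) * (INR n + 2))) n).
  { induction n as [|n IH]; [rewrite sum_O; simpl; field|].
    rewrite sum_Sn, <- IH, S_INR; unfold plus; simpl; pose proof (pos_INR n); field; lra. }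
  apply (is_lim_seq_ext _ _ (Finite 1) telescope).
  replace (Finite 1) with (Rbar_minus 1 0) by (simpl; f_equal; ring).
  apply is_lim_seq_minus'; [apply is_lim_seq_const|].
  replace (Finite 0) with (Rbar_inv p_infty) by reflexivity.
  apply is_lim_seq_inv; [|discriminate].
  apply is_lim_seq_plus with p_infty 2;
    [apply is_lim_seq_INR | apply is_lim_seq_const | reflexivity].
Qed.

Section CountableCovers.

Variables (T : Type) (code : T -> nat).
Hypothesis code_inj : forall t t', code t = code t' -> t = t'.

Lemma hausdorff_null_countable_cover s A :
  (forall delta eps, 0 < delta -> 0 < eps -> exists (D : T -> Prop) (U : T -> pt -> Prop),
    (forall p, A p -> exists t, D t /\ U t p) /\
    forall t, D t -> ang_diam (U t) <= delta /\
      rpow (ang_diam (U t)) s <= eps / ((INR (code t) + 1) * (INR (code t) + 2))) ->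
  hausdorff_null s A.
Proof.
  intros H; apply hausdorff_null_iff; intros delta eps Hdelta Heps.
  destruct (H delta (eps / 2) Hdelta ltac:(lra)) as (D & U & Hcov & HU).
  set (V := fun n p => exists t, D t /\ code t = n /\ U t p).
  set (b := fun n => eps / 2 * / ((INR n + 1) * (INR n + 2))).
  assert (HV : forall n, ang_diam (V n) <= delta /\ rpow (ang_diam (V n)) s <= b n).
  { intros n; destruct (classic (exists t, D t /\ code t = n)) as [(t & Dt & <-)|Hno].
    - rewrite (ang_diam_ext _ (U t)); [apply HU, Dt|].
      intros p; split; [intros (t' & _ & E & Up) | intros Up; exists t; auto].
      rewrite <- (code_inj _ _ E); exact Up.
    - assert (E : ang_diam (V n) <= 0).
      { apply ang_diam_subsingleton; intros p q (t & Dt & Et & _).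
        exfalso; apply Hno; exists t; auto. }
      split; [lra|]; rewrite rpow_nonpos by exact E; pose proof (pos_INR n).
      apply Rmult_le_pos; [lra | left; apply Rinv_0_lt_compat; nra]. }
  pose proof (is_series_scal_l (eps / 2) _ _ is_series_inv_pronic) as Hb.
  assert (Hex : ex_series b) by (eexists; exact Hb).
  assert (HV0 : forall n, 0 <= rpow (ang_diam (V n)) s <= b n)
    by (intros n; split; [apply rpow_ge0 | apply HV]).
  exists (Series (fun n => rpow (ang_diam (V n)) s)); split; [exists V; split; [|split]|].
  - intros p Ap; destruct (Hcov p Ap) as (t & Dt & Ut); exists (code t), t; auto.
  - apply HV.
  - apply Series_correct, (ex_series_le (V := R_CompleteNormedModule)) with (2 := Hex).
    intros n; change (Rabs (rpow (ang_diam (V n)) s) <= b n); rewrite Rabs_pos_eq; apply HV0.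
  - apply Rle_lt_trans with (Series b); [exact (Series_le _ _ HV0 Hex)|].
    rewrite (is_series_unique b _ Hb); change (eps / 2 * 1 < eps); lra.
Qed.

Lemma hausdorff_null_countable (F : T -> pt) s : hausdorff_null s (fun p => exists t, p = F t).
Proof.
  apply hausdorff_null_countable_cover; intros delta eps Hdelta Heps.
  exists (fun _ => True), (fun t p => p = F t); split; [intros p [t E]; exists t; auto|].
  intros t _; assert (E : ang_diam (fun p => p = F t) <= 0)
    by (apply ang_diam_subsingleton; intros p q -> ->; reflexivity).
  split; [lra|]; rewrite rpow_nonpos by exact E; pose proof (pos_INR (code t)).
  apply Rdiv_le_0_compat; nra.
Qed.

End CountableCovers.

Lemma hausdorff_dim_eq0 A : (forall s, 0 < s -> hausdorff_null s A) ->
  hausdorff_dim A = Finite 0.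
Proof.
  intros Hnull; apply Glb_Rbar_eq0; [intros s [Hs _]; lra|].
  intros eps Heps; exists (eps / 2); split; [split; [|apply Hnull]|]; lra.
Qed.

(** * Sequences of positive reals *)

Lemma finite_lower_bound (a : nat -> R) N : (forall i, (i < N)%nat -> 0 < a i) ->
  exists e, 0 < e /\ forall i, (i < N)%nat -> e <= a i.
Proof.
  induction N as [|N IH]; intros Ha; [exists 1; split; [lra | lia]|].
  destruct IH as (e & He & Hle); [auto|].
  exists (Rmin e (a N)); split; [apply Rmin_glb_lt; auto|].
  intros i Hi; destruct (Nat.eq_dec i N) as [->|]; [apply Rmin_r|].
  eapply Rle_trans; [apply Rmin_l | apply Hle; lia].
Qed.

Lemma half_pow_le m n : (m <= n)%nat -> (/ 2) ^ n <= (/ 2) ^ m.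
Proof.
  intros H; rewrite !pow_inv; apply Rinv_le_contravar; [apply pow_lt; lra|].
  apply Rle_pow; [lra | exact H].
Qed.

Lemma half_pow_eventually_lt e : 0 < e -> eventually (fun n => (/ 2) ^ n < e).
Proof.
  intros He; destruct (pow_lt_1_zero (/ 2)) with (2 := He) as [N HN];
    [rewrite Rabs_pos_eq; lra|].
  exists N; intros n Hn; specialize (HN n Hn); rewrite Rabs_pos_eq in HN; [exact HN|].
  apply pow_le; lra.
Qed.

Lemma is_lim_seq_superexponential a s b : (forall i, 0 < a i) -> 0 < s -> 0 < b ->
  is_lim_seq (fun i => ln (a i) / INR (S i)) m_infty ->
  is_lim_seq (fun i => Rpower (a i) s * b ^ S i) 0.
Proof.
  intros Ha Hs Hb Hlim; set (x := fun i => s * (ln (a i) / INR (S i)) + ln b).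
  assert (E : forall i, Rpower (a i) s * b ^ S i = exp (INR (S i) * x i)).
  { intros i; rewrite <- (Rpower_pow (S i) b Hb); unfold Rpower, x; rewrite <- exp_plus.
    f_equal; field; apply not_0_INR; lia. }
  assert (Hx : is_lim_seq x m_infty).
  { apply is_lim_seq_plus with m_infty (ln b); [|apply is_lim_seq_const | reflexivity].
    replace m_infty with (Rbar_mult s m_infty); [apply is_lim_seq_scal_l, Hlim|].
    apply is_Rbar_mult_unique, is_Rbar_mult_sym, is_Rbar_mult_m_infty_pos; exact Hs. }
  apply (is_lim_seq_le_le_loc (fun _ => 0) _ (fun i => exp (x i))).
  - destruct (proj2 (is_lim_seq_spec _ _) Hx 0) as [N HN]; exists N; intros i Hi.
    rewrite E; split; [left; apply exp_pos|]; specialize (HN i Hi).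
    apply Rnot_lt_le; intros Hlt; apply exp_lt_inv in Hlt.
    rewrite S_INR in Hlt; pose proof (pos_INR i); nra.
  - apply is_lim_seq_const.
  - apply (is_lim_comp_seq exp x m_infty 0 is_lim_exp_m); [|exact Hx].
    exists O; discriminate.
Qed.

(** * Words *)

Fixpoint reduced (w : list nat) : Prop :=
  match w with
  | [] => True
  | i :: w' => match w' with [] => True | j :: _ => i <> j end /\ reduced w'
  end.

Fixpoint word_prod (a : nat -> R) (w : list nat) : R :=
  match w with
  | [] => 1
  | i :: w' => a i * word_prod a w'
  end.

Lemma word_prod_gt0 a w : (forall i, 0 < a i) -> 0 < word_prod a w.
Proof. intros Ha; induction w; simpl; [lra | apply Rmult_lt_0_compat; auto]. Qed.

Lemma word_prod_ext a b w : (forall i, a i = b i) -> word_prod a w = word_prod b w.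
Proof. intros E; induction w as [|i w IH]; simpl; [|rewrite E, IH]; reflexivity. Qed.

Lemma word_prod_app a w w' : word_prod a (w ++ w') = word_prod a w * word_prod a w'.
Proof. induction w as [|i w IH]; simpl; [|rewrite IH]; ring. Qed.

Lemma word_prod_mul a b w :
  word_prod (fun i => a i * b i) w = word_prod a w * word_prod b w.
Proof. induction w as [|i w IH]; simpl; [|rewrite IH]; ring. Qed.

Lemma word_prod_Rpower a s w : (forall i, 0 < a i) ->
  word_prod (fun i => Rpower (a i) s) w = Rpower (word_prod a w) s.
Proof.
  intros Ha; induction w as [|i w IH]; simpl.
  - unfold Rpower; rewrite ln_1, Rmult_0_r, exp_0; reflexivity.
  - rewrite IH; apply Rpower_mult_distr; [apply Ha | apply word_prod_gt0, Ha].
Qed.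

Lemma word_prod_le_pow a q w : (forall i, 0 < a i <= q) -> word_prod a w <= q ^ length w.
Proof.
  intros Ha; induction w as [|i w IH]; simpl; [lra|].
  pose proof (word_prod_gt0 a w (fun j => proj1 (Ha j))).
  apply Rmult_le_compat; try apply Ha; try (left; apply Ha); lra.
Qed.

Definition prefix (f : nat -> nat) (k : nat) : list nat := map f (seq 0 k).

Lemma prefix_S f k : prefix f (S k) = prefix f k ++ [f k].
Proof. unfold prefix; rewrite seq_S, map_app; reflexivity. Qed.

Lemma length_prefix f k : length (prefix f k) = k.
Proof. unfold prefix; rewrite length_map, length_seq; reflexivity. Qed.

Lemma word_prod_prefix_lim a f : (forall i, 0 < a i) -> is_lim_seq a 0 ->
  filterlim f eventually eventually -> is_lim_seq (fun k => word_prod a (prefix f k)) 0.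
Proof.
  intros Ha Hlim Hf; assert (Hpos : forall k, 0 < word_prod a (prefix f k))
    by (intros k; apply word_prod_gt0, Ha).
  assert (Hser : ex_series (fun k => Rabs (word_prod a (prefix f k)))).
  { apply ex_series_DAlembert with 0; [lra | intros k; apply Rgt_not_eq, Hpos |].
    apply is_lim_seq_ext with (2 := is_lim_seq_subseq _ _ _ Hf Hlim); intros k.
    specialize (Hpos k); rewrite prefix_S, word_prod_app; simpl.
    replace (_ / _) with (a (f k)) by (field; lra).
    symmetry; apply Rabs_pos_eq; left; apply Ha. }
  apply is_lim_seq_ext with (2 := ex_series_lim_0 _ Hser); intros k.
  apply Rabs_pos_eq; left; apply Hpos.
Qed.

Fixpoint word_code (w : list nat) : nat :=
  match w with
  | [] => 0
  | i :: w' => 2 ^ i * (2 * word_code w' + 1)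
  end.

Lemma pow2_odd_inj i j a b : (2 ^ i * (2 * a + 1) = 2 ^ j * (2 * b + 1))%nat ->
  i = j /\ a = b.
Proof.
  revert j; induction i as [|i IH]; intros [|j] H; simpl in H; try lia.
  destruct (IH j) as [-> ->]; [simpl; lia | split; reflexivity].
Qed.

Lemma word_code_inj w w' : word_code w = word_code w' -> w = w'.
Proof.
  assert (Hpos : forall i w, (word_code (i :: w) <> 0)%nat).
  { intros i v; apply Nat.neq_mul_0; split; [apply Nat.pow_nonzero | ]; lia. }
  revert w'; induction w as [|i w IH]; intros [|j w'] H; [reflexivity | | |].
  { destruct (Hpos _ _ (eq_sym H)). }
  { destruct (Hpos _ _ H). }
  apply pow2_odd_inj in H as [-> E]; rewrite (IH w' E); reflexivity.
Qed.

Lemma word_code_succ_le w : INR (word_code w) + 1 <= word_prod (fun i => 2 ^ S i) w.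
Proof.
  induction w as [|i w IH]; [simpl; lra|]; cbn [word_code word_prod].
  rewrite mult_INR, pow_INR, plus_INR, mult_INR, <- tech_pow_Rmult.
  pose proof (pow_R1_Rle 2 i ltac:(lra)).
  change (INR 2) with 2; change (INR 1) with 1; nra.
Qed.

(** * Ping-pong for disjoint reflecting walls *)

(* [gap i] bounds below the distance from [ctr i] to all other balls and, being at most 1,
   also to the origin, since [ctr i] lies outside the unit disk. *)
Class wall_system := {
  ctr : nat -> pt;
  rad : nat -> R;
  gap : nat -> R;
  rad_gt0 i : 0 < rad i;
  ctr_orth i : nrm2 (ctr i) = 1 + rad i ^ 2;
  rad_le_gap i : 2 * rad i <= gap i;
  gap_le1 i : gap i <= 1;
  ctr_separated i j : i <> j -> gap i + rad j <= eucl_dist (ctr i) (ctr j)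
}.

Section Walls.

Context {W : wall_system}.

Definition ratio (i : nat) : R := rad i / gap i.
Definition refl (i : nat) : pt -> pt := inversion (ctr i) (rad i).

Definition in_ball (i : nat) (z : pt) : Prop := eucl_dist z (ctr i) <= rad i.
Definition in_core (i : nat) (z : pt) : Prop := eucl_dist z (ctr i) <= rad i / 2.

Lemma gap_gt0 i : 0 < gap i.
Proof. pose proof (rad_gt0 i); pose proof (rad_le_gap i); lra. Qed.

Lemma rad_ratio i : rad i = ratio i * gap i.
Proof. pose proof (gap_gt0 i); unfold ratio; field; lra. Qed.

Lemma ratio_gt0 i : 0 < ratio i.
Proof. apply Rdiv_lt_0_compat; [apply rad_gt0 | apply gap_gt0]. Qed.

Lemma ratio_le_half i : ratio i <= / 2.
Proof.
  pose proof (gap_gt0 i); pose proof (rad_le_gap i).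
  apply <- Rle_div_l; lra.
Qed.

Lemma core_ball i z : in_core i z -> in_ball i z.
Proof. unfold in_core, in_ball; pose proof (rad_gt0 i); lra. Qed.

Lemma ball_separated i j z : i <> j -> in_ball j z -> gap i <= eucl_dist z (ctr i).
Proof.
  intros Hij Hz; red in Hz; pose proof (ctr_separated i j Hij).
  pose proof (eucl_dist_triangle (ctr i) (ctr j) z).
  rewrite (eucl_dist_sym (ctr i) z) in *; lra.
Qed.

Lemma origin_ctr_ge1 i : 1 <= eucl_dist origin (ctr i).
Proof.
  rewrite eucl_dist_sym, eucl_dist_origin, ctr_orth, <- sqrt_1 at 1.
  apply sqrt_le_1_alt; nra.
Qed.

Lemma origin_separated i : gap i <= eucl_dist origin (ctr i).
Proof. pose proof (gap_le1 i); pose proof (origin_ctr_ge1 i); lra. Qed.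

Lemma core_nrm2 i z : in_core i z -> / 2 <= nrm2 z.
Proof.
  intros Hz; red in Hz; pose proof (origin_ctr_ge1 i); pose proof (rad_le_gap i).
  pose proof (gap_le1 i); pose proof (eucl_dist_triangle origin (ctr i) z).
  rewrite <- sqdist_origin, <- eucl_dist_sqr, eucl_dist_sym.
  assert (3 / 4 <= eucl_dist origin z) by lra; nra.
Qed.

Lemma ctr_dist_gt0 i z : in_closed_disk z -> 0 < eucl_dist z (ctr i).
Proof. apply center_dist_gt0 with (rad i); [apply rad_gt0 | apply ctr_orth]. Qed.

Lemma refl_closed_disk i z : in_closed_disk z -> in_closed_disk (refl i z).
Proof. apply inversion_closed_disk; [apply rad_gt0 | apply ctr_orth]. Qed.

Lemma refl_disk i z : in_disk z -> in_disk (refl i z).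
Proof. apply inversion_disk; [apply rad_gt0 | apply ctr_orth]. Qed.

Lemma refl_circle i z : on_circle z -> on_circle (refl i z).
Proof. apply inversion_circle; [apply rad_gt0 | apply ctr_orth]. Qed.

Lemma refl_involutive i z : in_closed_disk z -> refl i (refl i z) = z.
Proof. intros H; apply inversion_involutive; [apply rad_gt0 | apply ctr_dist_gt0, H]. Qed.

Lemma refl_dist_ctr i z : in_closed_disk z ->
  eucl_dist (refl i z) (ctr i) = rad i ^ 2 / eucl_dist z (ctr i).
Proof. intros H; apply inversion_dist_center, ctr_dist_gt0, H. Qed.

Lemma refl_in_core i z :
  in_closed_disk z -> gap i <= eucl_dist z (ctr i) -> in_core i (refl i z).
Proof.
  intros Hz Hg; red; rewrite refl_dist_ctr by assumption.
  pose proof (rad_gt0 i); pose proof (rad_le_gap i).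
  apply <- Rle_div_l; nra.
Qed.

Lemma core_refl_separated i z :
  in_closed_disk z -> in_core i z -> 2 * rad i <= eucl_dist (refl i z) (ctr i).
Proof.
  intros Hz Hg; red in Hg; rewrite refl_dist_ctr by assumption.
  pose proof (ctr_dist_gt0 i z Hz).
  apply -> Rle_div_r; nra.
Qed.

Lemma refl_contraction i z w : in_closed_disk z -> in_closed_disk w ->
  gap i <= eucl_dist z (ctr i) -> gap i <= eucl_dist w (ctr i) ->
  eucl_dist (refl i z) (refl i w) <= ratio i ^ 2 * eucl_dist z w.
Proof.
  intros Hz Hw Gz Gw; pose proof (ctr_dist_gt0 i z Hz); pose proof (ctr_dist_gt0 i w Hw).
  unfold refl; rewrite inversion_dist, rad_ratio by assumption.
  pose proof (gap_gt0 i); pose proof (eucl_dist_ge0 z w).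
  apply <- Rle_div_l; [|nra].
  replace ((ratio i * gap i) ^ 2 * eucl_dist z w)
    with (ratio i ^ 2 * eucl_dist z w * (gap i * gap i)) by ring.
  apply Rmult_le_compat_l; [|apply Rmult_le_compat; lra].
  apply Rmult_le_pos; [apply pow2_ge_0 | assumption].
Qed.

(** * The reflection groups *)

Fixpoint act (w : list nat) (z : pt) : pt :=
  match w with
  | [] => z
  | i :: w' => refl i (act w' z)
  end.

Definition reflection_group (P : nat -> Prop) (g : pt -> pt) : Prop :=
  exists w, Forall P w /\ eq_on_disk g (act w).

Lemma act_app w w' z : act (w ++ w') z = act w (act w' z).
Proof. induction w as [|i w IH]; simpl; [|rewrite IH]; reflexivity. Qed.

Lemma act_disk w z : in_disk z -> in_disk (act w z).
Proof. intros H; induction w; simpl; [|apply refl_disk]; assumption. Qed.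

Lemma act_closed_disk w z : in_closed_disk z -> in_closed_disk (act w z).
Proof. intros H; induction w; simpl; [|apply refl_closed_disk]; assumption. Qed.

Lemma act_circle w z : on_circle z -> on_circle (act w z).
Proof. intros H; induction w; simpl; [|apply refl_circle]; assumption. Qed.

Lemma act_rev_l w z : in_closed_disk z -> act (rev w) (act w z) = z.
Proof.
  intros H; induction w as [|i w IH]; simpl; [reflexivity|].
  rewrite act_app; simpl; rewrite refl_involutive; [exact IH|].
  apply act_closed_disk, H.
Qed.

Lemma act_rev_r w z : in_closed_disk z -> act w (act (rev w) z) = z.
Proof.
  intros H; pose proof (act_rev_l (rev w) z H) as E; rewrite rev_involutive in E; exact E.
Qed.

Lemma hdist_act w x y :
  in_disk x -> in_disk y -> hdist (act w x) (act w y) = hdist x y.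
Proof.
  intros Hx Hy; induction w as [|i w IH]; simpl; [reflexivity|].
  rewrite <- IH; apply hdist_inversion;
    [apply rad_gt0 | apply ctr_orth | apply act_disk .. ]; assumption.
Qed.

Lemma near_geodesic_act w a b z :
  in_closed_disk a -> in_closed_disk b -> in_closed_disk z ->
  near_geodesic a b z -> near_geodesic (act w a) (act w b) (act w z).
Proof.
  intros Ha Hb Hz H; induction w as [|i w IH]; [exact H|].
  apply near_geodesic_inversion; [apply rad_gt0 | apply ctr_orth | | | | exact IH];
    apply act_closed_disk; assumption.
Qed.

Lemma act_isometry w : is_isometry (act w).
Proof.
  split; [intros x; apply act_disk|]; split; [|apply hdist_act].
  intros y Hy; exists (act (rev w) y); split; [apply act_disk, Hy|].
  apply act_rev_r, disk_closed_disk, Hy.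
Qed.

Lemma reflection_group_subgroup P : is_subgroup (reflection_group P).
Proof.
  split; [|split; [|split]].
  - intros g (w & _ & E); exact (is_isometry_ext _ _ E (act_isometry w)).
  - exists []; split; [constructor | intros x _; reflexivity].
  - intros g h (w & Hw & Eg) (v & Hv & Eh); exists (w ++ v).
    split; [apply Forall_app; split; assumption|]; intros x Hx.
    rewrite act_app, Eh by exact Hx; apply Eg, act_disk, Hx.
  - intros g (w & Hw & E); exists (act (rev w)).
    split; [exists (rev w); split; [apply Forall_rev, Hw | intros x _; reflexivity]|].
    split; intros x Hx.
    + rewrite E by exact Hx; apply act_rev_l, disk_closed_disk, Hx.
    + rewrite E by (apply act_disk, Hx); apply act_rev_r, disk_closed_disk, Hx.
Qed.

Lemma reflection_group_respects_eq_on_disk P : respects_eq_on_disk (reflection_group P).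
Proof.
  intros g h Egh (w & Hw & Eh); exists w; split; [exact Hw|].
  intros x Hx; rewrite Egh by exact Hx; apply Eh, Hx.
Qed.

Lemma reflection_group_mono (P Q : nat -> Prop) g :
  (forall i, P i -> Q i) -> reflection_group P g -> reflection_group Q g.
Proof.
  intros HPQ (w & Hw & E); exists w; split; [|exact E].
  exact (Forall_impl _ HPQ Hw).
Qed.

Lemma reflection_group_act (P : nat -> Prop) w : Forall P w -> reflection_group P (act w).
Proof. intros Hw; exists w; split; [exact Hw | intros x _; reflexivity]. Qed.

Lemma reduce_word (P : nat -> Prop) w : Forall P w ->
  exists w', reduced w' /\ Forall P w' /\ eq_on_disk (act w) (act w').
Proof.
  induction 1 as [|i w Hi _ (w' & Hred & HP & E)].
  { exists []; repeat split; constructor. }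
  destruct w' as [|j v]; [|destruct (Nat.eq_dec i j) as [<-|Hij]].
  - exists [i]; repeat split; [auto|]; intros x Hx; simpl; rewrite (E x Hx); reflexivity.
  - exists v; repeat split; [apply Hred | inversion HP; assumption |].
    intros x Hx; simpl; rewrite (E x Hx); apply refl_involutive.
    apply act_closed_disk, disk_closed_disk, Hx.
  - exists (i :: j :: v); repeat split; [exact Hij | apply Hred .. | auto |].
    intros x Hx; simpl; rewrite (E x Hx); reflexivity.
Qed.

Lemma reflection_group_reduced (P : nat -> Prop) g : reflection_group P g ->
  exists w, reduced w /\ Forall P w /\ eq_on_disk g (act w).
Proof.
  intros (w & Hw & Eg); destruct (reduce_word P w Hw) as (v & Hred & Hv & E).
  exists v; repeat split; [assumption ..|]; intros x Hx; rewrite Eg by exact Hx; auto.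
Qed.

Lemma orbit_in_core i w : reduced (i :: w) -> in_core i (act (i :: w) origin).
Proof.
  pose proof (disk_closed_disk _ origin_in_disk) as O.
  revert i; induction w as [|j w IH]; intros i H.
  - apply refl_in_core; [exact O | apply origin_separated].
  - destruct H as [Hij H]; apply refl_in_core; [apply (act_closed_disk (j :: w)), O|].
    apply (ball_separated i j); [exact Hij | apply core_ball, IH, H].
Qed.

Lemma reflection_group_discrete P : discrete_subgroup (reflection_group P).
Proof.
  apply discrete_of_displacement_gap with (ln (1 + 2 * / 2)).
  - apply reflection_group_subgroup.
  - rewrite <- ln_1; apply ln_increasing; lra.
  - intros g Hg Hsmall; destruct (reflection_group_reduced P g Hg) as (w & Hred & _ & E).
    destruct w as [|i w]; [exact E|].
    rewrite (E _ origin_in_disk) in Hsmall.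
    pose proof (core_nrm2 _ _ (orbit_in_core i w Hred)) as Hfar.
    pose proof (hdist_origin_ge (/ 2) _ (act_disk (i :: w) _ origin_in_disk)); lra.
Qed.

Lemma refl_notin_reflection_group (P : nat -> Prop) i : ~ P i -> ~ reflection_group P (refl i).
Proof.
  intros Hi H; destruct (reflection_group_reduced P _ H) as (w & Hred & HP & E).
  pose proof (orbit_in_core i [] (conj I I)) as Hcore; simpl in Hcore.
  rewrite (E _ origin_in_disk) in Hcore; red in Hcore.
  pose proof (rad_gt0 i); pose proof (rad_le_gap i).
  destruct w as [|j w].
  - pose proof (origin_separated i); simpl in Hcore; lra.
  - assert (Hij : i <> j) by (intros <-; inversion HP; contradiction).
    pose proof (ball_separated i j _ Hij (core_ball _ _ (orbit_in_core j w Hred))); lra.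
Qed.

Definition Gamma : (pt -> pt) -> Prop := reflection_group (fun _ => True).

Lemma Gamma_act w : Gamma (act w).
Proof. apply reflection_group_act, Forall_forall; intros; exact I. Qed.

Lemma Gamma_finite_subset L : (forall l, In l L -> Gamma l) ->
  exists N, forall l, In l L -> reflection_group (fun i => (i < N)%nat) l.
Proof.
  induction L as [|l L IH]; intros H; [exists O; intros l []|].
  destruct IH as [N HN]; [intros k Hk; apply H; right; exact Hk|].
  destruct (H l (or_introl eq_refl)) as (w & _ & E).
  exists (Nat.max N (S (list_max w))); intros k [<-|Hk].
  - exists w; split; [|exact E].
    apply Forall_impl with (2 := proj1 (list_max_le w _) (le_n _)); simpl; lia.
  - apply reflection_group_mono with (2 := HN k Hk); intros; lia.
Qed.

Lemma Gamma_infinitely_generated : infinitely_generated Gamma.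
Proof.
  intros (L & Hgen); destruct (Gamma_finite_subset L (proj1 Hgen)) as [N HN].
  apply (refl_notin_reflection_group (fun i => (i < N)%nat) N); [lia|].
  apply (generated_by_subset _ _ L Hgen); [| | exact HN | exact (Gamma_act [N])].
  - apply reflection_group_subgroup.
  - apply reflection_group_respects_eq_on_disk.
Qed.

(** * Limit points *)

Lemma continuous_act w (z : R * R) :
  in_closed_disk z -> continuous (act w : R * R -> R * R) z.
Proof.
  intros Hz; induction w as [|i w IH]; [apply continuous_id|].
  apply (continuous_comp (act w : R * R -> R * R) (refl i : R * R -> R * R)); [exact IH|].
  apply continuous_inversion, ctr_dist_gt0, act_closed_disk, Hz.
Qed.

Lemma limit_set_act w xi : limit_set Gamma xi -> limit_set Gamma (act w xi).
Proof.
  intros Hxi; pose proof (proj1 Hxi) as Hc; apply limit_set_invariant.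
  - apply reflection_group_subgroup.
  - apply Gamma_act.
  - apply continuous_act, circle_closed_disk, Hc.
  - apply act_circle, Hc.
  - exact Hxi.
Qed.

Lemma limit_point_near_core xi eps : limit_set Gamma xi -> 0 < eps ->
  exists i z, in_core i z /\ eucl_dist xi z < eps.
Proof.
  intros [Hc Hlim] Heps; destruct (Hlim (Rmin eps 1)) as (g & Hg & Hdist).
  { apply Rmin_glb_lt; lra. }
  pose proof (Rmin_l eps 1); pose proof (Rmin_r eps 1).
  destruct (reflection_group_reduced _ g Hg) as (w & Hred & _ & E).
  rewrite (E _ origin_in_disk), eucl_dist_sym in Hdist; destruct w as [|i w].
  - simpl in Hdist; rewrite eucl_dist_origin, Hc, sqrt_1 in Hdist; lra.
  - exists i, (act (i :: w) origin); split; [exact (orbit_in_core i w Hred) | lra].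
Qed.

Definition balls_converge_to (accum : pt) : Prop := forall eps, 0 < eps ->
  exists N, forall i z, (N <= i)%nat -> in_ball i z -> eucl_dist z accum < eps.

Lemma act_rev_prefix_S f k z :
  act (rev (prefix f (S k))) z = refl (f k) (act (rev (prefix f k)) z).
Proof. rewrite prefix_S, rev_app_distr; reflexivity. Qed.

Definition coded_by (f : nat -> nat) (xi : pt) : Prop :=
  forall k, in_core (f k) (act (rev (prefix f k)) xi).

(* Arbitrary when [z] lies in no core. *)
Definition core_index (z : pt) : nat := epsilon (inhabits O) (fun i => in_core i z).

Fixpoint itinerary_image (xi : pt) (k : nat) : pt :=
  match k with
  | O => xi
  | S k' => refl (core_index (itinerary_image xi k')) (itinerary_image xi k')
  end.

Definition itinerary (xi : pt) (k : nat) : nat := core_index (itinerary_image xi k).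

Lemma act_rev_itinerary xi k : act (rev (prefix (itinerary xi) k)) xi = itinerary_image xi k.
Proof.
  induction k as [|k IH]; [reflexivity | rewrite act_rev_prefix_S, IH; reflexivity].
Qed.

Section Accumulation.

Variable accum : pt.
Hypothesis accum_balls : balls_converge_to accum.

Lemma limit_point_in_core xi : limit_set Gamma xi -> xi <> accum -> exists i, in_core i xi.
Proof.
  intros Hlim Hne; apply NNPP; intros H.
  pose proof (eucl_dist_gt0 xi accum Hne) as Hd; set (d := eucl_dist xi accum) in *.
  destruct (accum_balls (d / 2)) as [N HN]; [lra|].
  destruct (finite_lower_bound (fun i => eucl_dist xi (ctr i) - rad i / 2) N)
    as (e & He & Hout).
  { intros i _; assert (Hi : ~ in_core i xi) by (intros Hi; apply H; exists i; exact Hi).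
    unfold in_core in Hi; lra. }
  destruct (limit_point_near_core xi (Rmin e (d / 2)) Hlim) as (i & z & Hz & Hxz).
  { apply Rmin_glb_lt; lra. }
  pose proof (Rmin_l e (d / 2)); pose proof (Rmin_r e (d / 2)).
  destruct (Nat.lt_ge_cases i N) as [Hi|Hi].
  - specialize (Hout i Hi); red in Hz; pose proof (eucl_dist_triangle xi (ctr i) z); lra.
  - specialize (HN i z Hi (core_ball i z Hz)).
    pose proof (eucl_dist_triangle xi accum z); unfold d in *; lra.
Qed.

Lemma limit_point_coded xi : limit_set Gamma xi -> (forall w, xi <> act w accum) ->
  coded_by (itinerary xi) xi.
Proof.
  intros Hlim Hno k; set (w := prefix (itinerary xi) k).
  pose proof (limit_point_in_core _ (limit_set_act (rev w) xi Hlim)) as Hcore.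
  unfold w in Hcore at 2; rewrite act_rev_itinerary in Hcore.
  unfold w; rewrite act_rev_itinerary.
  apply (epsilon_spec (inhabits O) (fun i => in_core i (itinerary_image xi k))), Hcore.
  intros E; apply (Hno w).
  rewrite <- E; symmetry; apply act_rev_r, circle_closed_disk, Hlim.
Qed.

End Accumulation.

(** * Cylinders *)

Fixpoint cyl (w : list nat) (z : pt) : Prop :=
  match w with
  | [] => True
  | i :: w' => in_ball i z /\ cyl w' (refl i z)
  end.

Lemma cyl_dist w z z' : w <> [] -> reduced w ->
  in_closed_disk z -> in_closed_disk z' -> cyl w z -> cyl w z' ->
  eucl_dist z z' <= 2 * word_prod ratio w.
Proof.
  revert z z'; induction w as [|i w IH]; intros z z' Hne Hred Hz Hz' Cz Cz'; [easy|].
  destruct Cz as [Bz Cz], Cz' as [Bz' Cz']; pose proof (ratio_gt0 i).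
  pose proof (ratio_le_half i); destruct w as [|j w].
  - pose proof (eucl_dist_triangle z z' (ctr i)); red in Bz, Bz'.
    rewrite (eucl_dist_sym (ctr i)) in *; rewrite rad_ratio in *.
    pose proof (gap_le1 i); simpl; nra.
  - destruct Hred as [Hij Hred].
    pose proof (refl_closed_disk i z Hz) as Dz; pose proof (refl_closed_disk i z' Hz') as Dz'.
    pose proof (IH _ _ ltac:(easy) Hred Dz Dz' Cz Cz') as Hdiam.
    pose proof (refl_contraction i _ _ Dz Dz'
      (ball_separated i j _ Hij (proj1 Cz)) (ball_separated i j _ Hij (proj1 Cz'))) as Hcontr.
    rewrite !refl_involutive in Hcontr by assumption.
    pose proof (eucl_dist_ge0 (refl i z) (refl i z')).
    apply Rle_trans with (ratio i * eucl_dist (refl i z) (refl i z')).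
    + eapply Rle_trans; [exact Hcontr|]; apply Rmult_le_compat_r; [assumption | nra].
    + change (word_prod ratio (i :: j :: w)) with (ratio i * word_prod ratio (j :: w)); nra.
Qed.

Lemma cyl_act w i a : reduced (w ++ [i]) -> in_closed_disk a -> in_ball i a ->
  cyl (w ++ [i]) (act w a).
Proof.
  intros Hred Ha Bi; induction w as [|j w IH]; [split; [exact Bi | exact I]|].
  destruct Hred as [Hj Hred]; specialize (IH Hred).
  pose proof (act_closed_disk w a Ha) as Hc.
  split; [|simpl; rewrite refl_involutive; assumption].
  apply core_ball, refl_in_core; [exact Hc|].
  destruct w as [|k w]; (eapply ball_separated; [exact Hj | apply IH]).
Qed.

Lemma word_prod_ratio_prefix (f : nat -> nat) k : word_prod ratio (prefix f k) <= (/ 2) ^ k.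
Proof.
  rewrite <- (length_prefix f k) at 2; apply word_prod_le_pow; intros i.
  split; [apply ratio_gt0 | apply ratio_le_half].
Qed.

(** * Coded points and the radii ending at them *)

Section Coding.

Variables (xi : pt) (f : nat -> nat).
Hypotheses (xi_circle : on_circle xi) (f_codes : coded_by f xi).

Lemma coded_by_neq k : f k <> f (S k).
Proof.
  intros E; pose proof (f_codes k) as Hcore; pose proof (f_codes (S k)) as Hcore'.
  rewrite act_rev_prefix_S, <- E in Hcore'.
  apply core_refl_separated in Hcore; [|apply act_closed_disk, circle_closed_disk, xi_circle].
  red in Hcore'; pose proof (rad_gt0 (f k)); lra.
Qed.

Lemma prefix_reduced k : reduced (prefix f k).
Proof.
  unfold prefix; generalize 0%nat; induction k as [|k IH]; intros a; simpl; [exact I|].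
  split; [|apply IH]; destruct k; simpl; [exact I | apply coded_by_neq].
Qed.

Lemma prefix_S_cyl k z : in_closed_disk z -> in_ball (f k) (act (rev (prefix f k)) z) ->
  cyl (prefix f (S k)) z.
Proof.
  intros Hz Hb; pose proof (prefix_reduced (S k)) as Hred; rewrite prefix_S in *.
  rewrite <- (act_rev_r (prefix f k) z Hz).
  apply cyl_act; [exact Hred | apply act_closed_disk, Hz | exact Hb].
Qed.

Lemma prefix_cyl k : cyl (prefix f k) xi.
Proof.
  destruct k as [|k]; [exact I|].
  apply prefix_S_cyl; [apply circle_closed_disk, xi_circle | apply core_ball, f_codes].
Qed.

Lemma prefix_origin_separated k :
  gap (f k) <= eucl_dist (act (rev (prefix f k)) origin) (ctr (f k)).
Proof.
  induction k as [|k IH]; [apply origin_separated|].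
  apply (ball_separated _ (f k)); [apply not_eq_sym, coded_by_neq|].
  rewrite act_rev_prefix_S; apply core_ball, refl_in_core; [|exact IH].
  apply act_closed_disk, disk_closed_disk, origin_in_disk.
Qed.

Lemma radius_crosses_wall k : exists s, 0 <= s < 1 /\
  eucl_dist (act (rev (prefix f k)) (scal s xi)) (ctr (f k)) = rad (f k).
Proof.
  set (w := rev (prefix f k)); set (i := f k).
  pose (h := fun s => rad i ^ 2 - sqdist (act w (scal s xi)) (ctr i)).
  assert (h_cont : forall s, 0 <= s <= 1 -> continuity_pt h s).
  { intros s Hs; apply continuity_pt_minus; [apply continuity_pt_const; intros u v; easy|].
    apply continuity_pt_filterlim.
    apply (continuous_comp (fun s => scal s xi : R * R) (fun z => sqdist (act w z) (ctr i)));
      [apply continuous_scal|].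
    apply (continuous_comp (act w : R * R -> R * R) (fun z => sqdist z (ctr i)));
      [apply continuous_act, scal_in_closed_disk; assumption | apply continuous_sqdist]. }
  pose proof (rad_gt0 i); pose proof (rad_le_gap i).
  assert (h0 : h 0 < 0).
  { unfold h; rewrite scal_0, <- eucl_dist_sqr.
    pose proof (prefix_origin_separated k) as Hsep; fold w i in Hsep; nra. }
  assert (h1 : 0 < h 1).
  { unfold h; rewrite scal_1, <- eucl_dist_sqr.
    pose proof (f_codes k) as Hcore; red in Hcore; fold w i in Hcore.
    pose proof (eucl_dist_ge0 (act w xi) (ctr i)); nra. }
  destruct (IVT_interv h 0 1 h_cont Rlt_0_1 h0 h1) as (s & Hs & Es).
  exists s; split.
  - destruct (Req_dec s 1) as [->|]; lra.
  - apply Rsqr_inj; [apply eucl_dist_ge0 | lra |].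
    rewrite !Rsqr_pow2, eucl_dist_sqr; unfold h in Es; lra.
Qed.

(* The images of both ends of the radius stay away from the wall, by [rad] and [rad / 2],
   so the crossing point cannot be close to the circle. *)
Lemma crossing_depth k s : 0 <= s < 1 ->
  let y := act (rev (prefix f k)) (scal s xi) in
  eucl_dist y (ctr (f k)) = rad (f k) -> rad (f k) ^ 2 / 4 <= 1 - nrm2 y.
Proof.
  intros Hs y Hy; set (w := rev (prefix f k)) in *; set (i := f k) in *.
  pose proof (circle_closed_disk _ xi_circle) as Dxi.
  pose proof (disk_closed_disk _ origin_in_disk) as Dorigin.
  pose proof (disk_closed_disk _ (scal_in_disk s xi xi_circle Hs)) as Ds.
  assert (Hnear : near_geodesic (act w origin) (act w xi) y).
  { apply near_geodesic_act; [assumption .. |].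
    apply near_geodesic_radius; [exact xi_circle | lra]. }
  pose proof (rad_gt0 i); pose proof (rad_le_gap i).
  assert (y_origin : rad i <= eucl_dist y (act w origin)).
  { pose proof (prefix_origin_separated k) as Hsep; fold w i in Hsep.
    pose proof (eucl_dist_triangle (act w origin) (ctr i) y).
    rewrite (eucl_dist_sym (act w origin) y) in *; lra. }
  assert (y_xi : rad i / 2 <= eucl_dist y (act w xi)).
  { pose proof (f_codes k) as Hcore; red in Hcore; fold w i in Hcore.
    pose proof (eucl_dist_triangle y (ctr i) (act w xi)); lra. }
  pose proof (near_geodesic_depth _ _ y (rad i) (rad i / 2)
    (act_closed_disk w _ Dorigin) (act_closed_disk w _ Dxi) (act_closed_disk w _ Ds) Hnear).
  lra.
Qed.

Lemma crossing_near_endpoint k s : 0 <= s < 1 ->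
  eucl_dist (act (rev (prefix f k)) (scal s xi)) (ctr (f k)) = rad (f k) ->
  1 - s <= (/ 2) ^ k.
Proof.
  intros Hs Hcross; pose proof (circle_closed_disk _ xi_circle) as Dxi.
  pose proof (disk_closed_disk _ (scal_in_disk s xi xi_circle Hs)) as Ds.
  rewrite <- (eucl_dist_radius xi s 1 xi_circle), scal_1 by lra.
  apply Rle_trans with (2 * word_prod ratio (prefix f (S k))).
  - apply cyl_dist; [| apply prefix_reduced | exact Ds | exact Dxi | | apply prefix_cyl].
    + discriminate.
    + apply prefix_S_cyl; [exact Ds | red; lra].
  - pose proof (word_prod_ratio_prefix f (S k)) as H; simpl in H |- *; lra.
Qed.

Lemma nonconical_code_escapes :
  nonconical_limit_set Gamma xi -> filterlim f eventually eventually.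
Proof.
  intros [_ Hnc] P [N HP].
  destruct (finite_lower_bound rad N) as (m & Hm & Hrad); [intros i _; apply rad_gt0|].
  destruct (Hnc (arcosh (1 + 2 / (m ^ 2 / 4)))) as [T HT].
  destruct (half_pow_eventually_lt (exp (- T)) (exp_pos _)) as [K HK].
  exists K; intros k Hk; apply HP; destruct (Nat.le_gt_cases N (f k)) as [|Hlt]; [easy|].
  exfalso; specialize (Hrad (f k) Hlt); specialize (HK k Hk).
  destruct (radius_crosses_wall k) as (s & Hs & Hcross).
  pose proof (crossing_depth k s Hs Hcross) as Hdepth.
  pose proof (crossing_near_endpoint k s Hs Hcross) as Hnear.
  pose proof (scal_in_disk s xi xi_circle Hs) as Ds.
  destruct (geod_ray_reaches xi T s Hs) as (t & Ht & Et); [lra|].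
  apply (HT t Ht _ (Gamma_act (prefix f k)) (act (rev (prefix f k)) (scal s xi))).
  - apply act_disk, Ds.
  - apply hdist_origin_le; split; nra.
  - rewrite Et; apply act_rev_r, disk_closed_disk, Ds.
Qed.

End Coding.

(** * Dimension of the nonconical limit set *)

Definition escaping_points (xi : pt) : Prop :=
  on_circle xi /\ exists f, coded_by f xi /\ filterlim f eventually eventually.

Definition covering_cost (s : R) (i : nat) : R := Rpower (ratio i) s * 4 ^ S i.

(* The factor [4 ^ S i] in the cost pays for the number of words:
   [word_prod (fun i => 4 ^ S i) w] is at least [(word_code w + 1) ^ 2]. *)
Definition thin (s delta eps : R) (w : list nat) : Prop :=
  w <> [] /\ reduced w /\ 6 * word_prod ratio w <= delta /\
  2 * Rpower 6 s * word_prod (covering_cost s) w <= eps.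

Lemma ang_diam_cyl w : w <> [] -> reduced w -> ang_diam (cyl w) <= 6 * word_prod ratio w.
Proof.
  intros Hne Hred; pose proof (word_prod_gt0 ratio w ratio_gt0).
  apply ang_diam_le; [lra|]; intros p q Cp Cq Dp Dq.
  pose proof (ang_dist_le p q Dp Dq).
  pose proof (cyl_dist w p q Hne Hred (circle_closed_disk p Dp) (circle_closed_disk q Dq)
    Cp Cq); lra.
Qed.

Lemma thin_cyl_content s delta eps w : 0 < s -> thin s delta eps w ->
  rpow (ang_diam (cyl w)) s <= eps / ((INR (word_code w) + 1) * (INR (word_code w) + 2)).
Proof.
  intros Hs (Hne & Hred & _ & Hcost); pose proof (pos_INR (word_code w)).
  pose proof (word_prod_gt0 ratio w ratio_gt0).
  eapply Rle_trans; [apply rpow_le_Rpower; [lra | apply ang_diam_cyl; assumption]|].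
  apply -> Rle_div_r; [|nra]; eapply Rle_trans; [|exact Hcost].
  unfold covering_cost; rewrite word_prod_mul, word_prod_Rpower by apply ratio_gt0.
  rewrite <- Rpower_mult_distr by lra.
  replace (2 * Rpower 6 s * _) with
    (Rpower 6 s * Rpower (word_prod ratio w) s * (2 * word_prod (fun i => 4 ^ S i) w)) by ring.
  apply Rmult_le_compat_l; [left; apply Rmult_lt_0_compat; apply exp_pos|].
  assert (E : word_prod (fun i => 4 ^ S i) w = word_prod (fun i => 2 ^ S i) w ^ 2).
  { rewrite <- Rsqr_pow2; unfold Rsqr; rewrite <- word_prod_mul.
    apply word_prod_ext; intros i; rewrite <- Rpow_mult_distr; f_equal; ring. }
  rewrite E; pose proof (word_code_succ_le w); nra.
Qed.

Lemma escaping_code_thin s delta eps xi f : 0 < delta -> 0 < eps ->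
  is_lim_seq (covering_cost s) 0 -> on_circle xi -> coded_by f xi ->
  filterlim f eventually eventually -> exists k, thin s delta eps (prefix f k).
Proof.
  intros Hdelta Heps Hcost Hxi Hf Hesc.
  assert (Hconst : 0 < 2 * Rpower 6 s) by (pose proof (exp_pos (s * ln 6)); unfold Rpower; lra).
  assert (Hlim : is_lim_seq (fun k => word_prod (covering_cost s) (prefix f k)) 0).
  { apply word_prod_prefix_lim; [|exact Hcost | exact Hesc]; intros i.
    apply Rmult_lt_0_compat; [apply exp_pos | apply pow_lt; lra]. }
  assert (Heps' : 0 < eps / (2 * Rpower 6 s)) by (apply Rdiv_lt_0_compat; lra).
  destruct (proj2 (is_lim_seq_spec _ _) Hlim (mkposreal _ Heps')) as [K HK].
  destruct (half_pow_eventually_lt (delta / 6)) as [L HL]; [lra|].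
  set (k := S (K + L)); exists k; split; [|split; [exact (prefix_reduced xi f Hxi Hf k)|split]].
  - discriminate.
  - specialize (HL k ltac:(unfold k; lia)); pose proof (word_prod_ratio_prefix f k); lra.
  - specialize (HK k ltac:(unfold k; lia)); cbn [pos] in HK.
    rewrite Rminus_0_r in HK; apply Rabs_lt_between in HK; destruct HK as [_ HK]; left.
    apply <- Rlt_div_r in HK; [lra | exact Hconst].
Qed.

Lemma escaping_points_null s : 0 < s -> is_lim_seq (covering_cost s) 0 ->
  hausdorff_null s escaping_points.
Proof.
  intros Hs Hcost; apply (hausdorff_null_countable_cover _ word_code word_code_inj).
  intros delta eps Hdelta Heps; exists (thin s delta eps), cyl; split.
  - intros xi (Hxi & f & Hf & Hesc).
    destruct (escaping_code_thin s delta eps xi f) as [k Hk]; [assumption ..|].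
    exists (prefix f k); split; [exact Hk | exact (prefix_cyl xi f Hxi Hf k)].
  - intros w Hw; split; [|exact (thin_cyl_content s delta eps w Hs Hw)].
    destruct Hw as (Hne & Hred & Hsmall & _).
    exact (Rle_trans _ _ _ (ang_diam_cyl w Hne Hred) Hsmall).
Qed.

Lemma nonconical_limit_set_null (accum : pt) s :
  balls_converge_to accum -> is_lim_seq (fun i => ln (ratio i) / INR (S i)) m_infty ->
  0 < s -> hausdorff_null s (nonconical_limit_set Gamma).
Proof.
  intros Haccum Hratio Hs.
  apply hausdorff_null_subset with
    (fun xi => (exists w, xi = act w accum) \/ escaping_points xi).
  - intros xi Hxi; destruct (classic (exists w, xi = act w accum)) as [|Hno]; [left; easy|].
    right; pose proof (proj1 Hxi) as Hlim; split; [apply Hlim|].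
    assert (Hf : coded_by (itinerary xi) xi).
    { apply (limit_point_coded accum Haccum xi Hlim); intros w E; apply Hno; exists w; easy. }
    exists (itinerary xi); split; [exact Hf|].
    exact (nonconical_code_escapes xi _ (proj1 Hlim) Hf Hxi).
  - apply hausdorff_null_union; [apply (hausdorff_null_countable _ word_code word_code_inj)|].
    apply escaping_points_null; [exact Hs|].
    apply is_lim_seq_superexponential; [apply ratio_gt0 | exact Hs | lra | exact Hratio].
Qed.

End Walls.

(** * Dyadic walls *)

Definition dyadic_height (i : nat) : R := (/ 2) ^ S i.
Definition dyadic_gap (i : nat) : R := dyadic_height i / 4.
Definition dyadic_rad (i : nat) : R := dyadic_gap i * (/ 2) ^ (S i * S i).
Definition dyadic_ctr (i : nat) : pt :=
  (sqrt (1 + dyadic_rad i ^ 2 - dyadic_height i ^ 2), dyadic_height i).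

Lemma dyadic_height_bounds i : 0 < dyadic_height i <= / 2.
Proof.
  split; [apply pow_lt; lra|]; rewrite <- (pow_1 (/ 2)); apply half_pow_le; lia.
Qed.

Lemma dyadic_height_lt i j : (i < j)%nat -> dyadic_height j <= dyadic_height i / 2.
Proof.
  intros H; pose proof (half_pow_le (S (S i)) (S j) ltac:(lia)).
  unfold dyadic_height; simpl in *; lra.
Qed.

Lemma dyadic_rad_bounds i : 0 < dyadic_rad i <= dyadic_height i / 8.
Proof.
  pose proof (dyadic_height_bounds i); pose proof (half_pow_le 1 (S i * S i) ltac:(lia)) as Hle.
  pose proof (pow_lt (/ 2) (S i * S i) ltac:(lra)); rewrite pow_1 in Hle.
  unfold dyadic_rad, dyadic_gap; split; nra.
Qed.

Lemma dyadic_ctr_sqr i : fst (dyadic_ctr i) ^ 2 = 1 + dyadic_rad i ^ 2 - dyadic_height i ^ 2.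
Proof. apply pow2_sqrt; pose proof (dyadic_height_bounds i); nra. Qed.

Lemma dyadic_ctr_orth i : nrm2 (dyadic_ctr i) = 1 + dyadic_rad i ^ 2.
Proof. pose proof (dyadic_ctr_sqr i); unfold nrm2; simpl snd; lra. Qed.

Lemma dyadic_rad_gt0 i : 0 < dyadic_rad i.
Proof. apply dyadic_rad_bounds. Qed.

Lemma dyadic_rad_le_gap i : 2 * dyadic_rad i <= dyadic_gap i.
Proof. pose proof (dyadic_rad_bounds i); unfold dyadic_gap; lra. Qed.

Lemma dyadic_gap_le1 i : dyadic_gap i <= 1.
Proof. pose proof (dyadic_height_bounds i); unfold dyadic_gap; lra. Qed.

Lemma dyadic_ctr_separated i j : i <> j ->
  dyadic_gap i + dyadic_rad j <= eucl_dist (dyadic_ctr i) (dyadic_ctr j).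
Proof.
  intros Hij; eapply Rle_trans; [|apply eucl_dist_coord]; simpl snd.
  pose proof (dyadic_rad_bounds j); unfold dyadic_gap.
  destruct (proj1 (Nat.lt_gt_cases i j) Hij) as [Hlt|Hlt]; apply dyadic_height_lt in Hlt.
  - eapply Rle_trans; [|apply Rle_abs]; lra.
  - rewrite Rabs_minus_sym; eapply Rle_trans; [|apply Rle_abs]; lra.
Qed.

#[local] Instance dyadic_walls : wall_system := {|
  ctr := dyadic_ctr;
  rad := dyadic_rad;
  gap := dyadic_gap;
  rad_gt0 := dyadic_rad_gt0;
  ctr_orth := dyadic_ctr_orth;
  rad_le_gap := dyadic_rad_le_gap;
  gap_le1 := dyadic_gap_le1;
  ctr_separated := dyadic_ctr_separated
|}.

Lemma dyadic_ctr_accum i : eucl_dist (dyadic_ctr i) (1, 0) <= 2 * dyadic_height i.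
Proof.
  pose proof (dyadic_ctr_sqr i); pose proof (dyadic_height_bounds i).
  pose proof (dyadic_rad_bounds i); assert (0 <= fst (dyadic_ctr i)) by apply sqrt_pos.
  eapply Rle_trans; [apply eucl_dist_le_coord|]; simpl snd.
  change (fst (1, 0)) with 1; rewrite Rminus_0_r, (Rabs_pos_eq (dyadic_height i)) by lra.
  assert (Rabs (fst (dyadic_ctr i) - 1) <= dyadic_height i) by (apply Rabs_le; split; nra); lra.
Qed.

Lemma dyadic_balls_converge : balls_converge_to (1, 0).
Proof.
  intros eps Heps; destruct (half_pow_eventually_lt (eps / 3)) as [N HN]; [lra|].
  exists N; intros i z Hi Hz; specialize (HN (S i) ltac:(lia)).
  pose proof (eucl_dist_triangle z (1, 0) (ctr i)); pose proof (dyadic_ctr_accum i).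
  pose proof (dyadic_rad_bounds i); red in Hz; simpl ctr in *; simpl rad in *.
  change ((/ 2) ^ S i) with (dyadic_height i) in HN; lra.
Qed.

Lemma dyadic_ratio i : ratio i = (/ 2) ^ (S i * S i).
Proof.
  pose proof (dyadic_height_bounds i); change (ratio i) with (dyadic_rad i / dyadic_gap i).
  unfold dyadic_rad, dyadic_gap; field; lra.
Qed.

Lemma dyadic_ratio_superexponential : is_lim_seq (fun i => ln (ratio i) / INR (S i)) m_infty.
Proof.
  assert (E : forall i, - ln 2 * INR (S i) = ln (ratio i) / INR (S i)).
  { intros i; rewrite dyadic_ratio, ln_pow, mult_INR, ln_Rinv by lra.
    field; apply not_0_INR; lia. }
  apply (is_lim_seq_ext _ _ _ E).
  replace m_infty with (Rbar_mult (- ln 2) p_infty).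
  - apply is_lim_seq_scal_l, (is_lim_seq_incr_1 INR), is_lim_seq_INR.
  - apply is_Rbar_mult_unique, is_Rbar_mult_sym, is_Rbar_mult_p_infty_neg; simpl.
    pose proof ln_lt_2; lra.
Qed.

Theorem theorem1p4 :
  exists G : (pt -> pt) -> Prop,
    discrete_subgroup G /\ infinitely_generated G /\
    hausdorff_dim (nonconical_limit_set G) = Finite 0.
Proof.
  exists Gamma; split; [apply reflection_group_discrete|].
  split; [exact Gamma_infinitely_generated|].
  apply hausdorff_dim_eq0; intros s.
  apply (nonconical_limit_set_null (1, 0)).
  - exact dyadic_balls_converge.
  - exact dyadic_ratio_superexponential.
Qed.
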